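(* Let $N_1<N_2<\cdots$ be natural numbers, $\mathbf{N}=([N_s])_{s\in\mathbb{N}}$, and let $\mathcal{A}\subset\ell^\infty(\mathbb{Z})$ be a separable, translation invariant $C^*$-subalgebra that admits logarithmic averages along $\mathbf{N}$. Then there exists a separable, translation invariant $C^*$-subalgebra $\mathcal{A}'\subset\ell^\infty(\mathbb{Z})$ that admits logarithmic averages along $\mathbf{N}$, contains $\mathcal{A}$, and has the following property: for every $f\in\mathcal{A}'$ there exist $f_{\mathrm{str}},f_{\mathrm{rnd}}\in\mathcal{A}'$ with $f=f_{\mathrm{str}}+f_{\mathrm{rnd}}$, where $f_{\mathrm{str}}$ is locally quasiperiodic and $f_{\mathrm{rnd}}$ is locally aperiodic (both with respect to logarithmic averages along $\mathbf{N}$). Moreover, if $f$ takes values in a closed interval $[a,b]\subset\mathbb{R}$, then so does $f_{\mathrm{str}}$.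
   Context: $[N]=\{1,\dots,N\}$; for finite nonempty $B\subset\mathbb{N}$, $\mathbb{E}^{\log}_{n\in B}f(n)=\big(\sum_{n\in B}f(n)/n\big)/\big(\sum_{n\in B}1/n\big)$ and $\mathbb{E}_{h\in[H]}$ denotes the uniform average. $\ell^\infty(\mathbb{Z})$ is the space of bounded functions $\mathbb{Z}\to\mathbb{C}$ with sup norm; a $C^*$-subalgebra is a norm-closed subset containing $1_{\mathbb{Z}}$ closed under linear combinations, products and complex conjugation; separable means having a countable dense subset; translation invariant means $n\mapsto f(n+b)$ lies in it for all $f$ in it and $b\in\mathbb{Z}$. It admits logarithmic averages along $\mathbf{N}$ if $\mathbb{E}^{\log}_{n\in\mathbf{N}}f(n):=\lim_{s\to\infty}\mathbb{E}^{\log}_{n\in[N_s]}f(n)$ exists for all $f$ in it. An element $f$ is locally aperiodic if for all $q\in\mathbb{Z}\setminus\{0\}$, $\lim_{H\to\infty}\mathbb{E}^{\log}_{n\in\mathbf{N}}\big|\mathbb{E}_{h\in[H]}f(n+qh)\big|^2=0$; it is locally quasiperiodic if for every $\epsilon>0$ there is $q\in\mathbb{N}$ with $\sup_{m\in\mathbb{N}}\mathbb{E}^{\log}_{n\in\mathbf{N}}|f(n+qm)-f(n)|^2\le\epsilon$. *)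

(* Defs.v *)
From HB Require Import structures.
From mathcomp Require Import all_boot all_order all_algebra.
From mathcomp Require Import all_classical all_reals all_analysis.
From mathcomp Require Import complex.

Set Implicit Arguments.
Unset Strict Implicit.
Unset Printing Implicit Defensive.

Import Order.TTheory GRing.Theory Num.Theory.
Import numFieldNormedType.Exports.

Local Open Scope classical_set_scope.
Local Open Scope ring_scope.
Local Open Scope complex_scope.

(* Functions are defined on [int]; averages run over the positive integers,
   so [[N]] is the range [1 <= n < N.+1]. *)
Definition Eavg (K : numFieldType) (H : nat) (f : nat -> K) : K :=
  (\sum_(1 <= h < H.+1) f h) / H%:R.

Definition Elog (K : numFieldType) (N : nat) (f : int -> K) : K :=
  (\sum_(1 <= n < N.+1) f n%:Z / n%:R) / (\sum_(1 <= n < N.+1) n%:R^-1).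

(* [Ns s] is the s-th scale, with s counted from 0. *)
Definition has_Elog (K : numFieldType) (Ns : nat -> nat) (f : int -> K) : Prop :=
  cvg ((fun s : nat => Elog (Ns s) f) @ \oo).

(* The value is meaningful only when [has_Elog Ns f]. *)
Definition Eloglim (K : numFieldType) (Ns : nat -> nat) (f : int -> K) : K :=
  lim ((fun s : nat => Elog (Ns s) f) @ \oo).

Section linfty.
Variable R : realType.
Implicit Types (f g : int -> R[i]) (A : set (int -> R[i])).

(* The modulus of a complex number as an element of [R]; the norm [`|z|]
   provided by the library has values in [R[i]]. *)
Definition modc (z : R[i]) : R := ComplexField.Normc.normc z.

Definition linfty : set (int -> R[i]) :=
  [set f | exists M : R, forall n, modc (f n) <= M].

Definition supnorm f : R := sup (range (fun n => modc (f n))).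

Record Cstar_subalgebra A : Prop := {
  Cstar_linfty : A `<=` linfty ;
  Cstar_one : A (fun=> 1) ;
  Cstar_lin : forall (a b : R[i]) f g,
    A f -> A g -> A (fun n => a * f n + b * g n) ;
  Cstar_mul : forall f g, A f -> A g -> A (fun n => f n * g n) ;
  Cstar_conj : forall f, A f -> A (fun n => (f n)^*) ;
  Cstar_closed : forall f, linfty f ->
    (forall e : R, 0 < e ->
       exists2 g, A g & supnorm (fun n => f n - g n) < e) ->
    A f }.

Definition norm_separable A : Prop :=
  exists D : set (int -> R[i]), [/\ countable D, D `<=` A &
    forall f, A f -> forall e : R, 0 < e ->
      exists2 g, D g & supnorm (fun n => f n - g n) < e].

Definition translation_invariant A : Prop :=
  forall f (b : int), A f -> A (fun n => f (n + b)).

Definition admits_Elog (Ns : nat -> nat) A : Prop :=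
  forall f, A f -> has_Elog Ns f.

Definition locally_aperiodic (Ns : nat -> nat) f : Prop :=
  forall q : int, q != 0 ->
    (fun H : nat => Eloglim Ns (fun n : int =>
       modc (Eavg H (fun h => f (n + q * h%:Z))) ^+ 2)) @ \oo --> (0 : R).

(* The supremum is taken in the extended reals, where it needs no boundedness
   side condition. *)
Definition locally_quasiperiodic (Ns : nat -> nat) f : Prop :=
  forall e : R, 0 < e -> exists2 q : nat, (0 < q)%N &
    (ereal_sup [set (Eloglim Ns (fun n : int =>
       modc (f (n + q%:Z * m%:Z) - f n) ^+ 2))%:E | m in [set m | (0 < m)%N]]
     <= e%:E)%E.

Definition takes_values_in_itv (a b : R) f : Prop :=
  range f `<=` [set x%:C | x in `[a, b]].

End linfty.

(* Main.v *)
Require Import Defs.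
From mathcomp Require Import all_boot all_order all_algebra.
From mathcomp Require Import all_classical all_reals all_analysis.
From mathcomp Require Import complex ring lra.

(** Write Q(f) for the limit of the logarithmic averages of |f|^2 along the
  scales. The averaging operators available are the convex combinations of the
  shifts by multiples of k!. Among them some M_k nearly minimises Q(M_k f);
  since the sets of operators decrease with k, the parallelogram law makes the
  M_k f a Cauchy sequence for Q and makes M_k f nearly invariant under all
  shifts by multiples of k!. Composing near-minimisers gives a single M_k that
  serves the first k members of a dense sequence of A.

  The limit is realised by one operator (S f)(n) = M_{kappa(n)} f(n), where
  kappa tends to infinity so slowly that every initial segment [1, N_s] is,
  up to negligible logarithmic mass, covered by two consecutive values of
  kappa. Being pointwise a convex combination of shifts, S is linear, contracts
  the sup norm and preserves the range [a, b]; it is also bounded for Q. Hence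
  the closure of A for Q (within bounded functions) is stable under S, S f is
  locally quasiperiodic for every f in it, and f - S f is locally aperiodic
  because averages of f - M_k f along q telescope. The algebra A' is the norm
  closure of the countable set generated from a dense sequence of A by sums,
  products, conjugation, shifts and S. *)

Set Implicit Arguments.
Unset Strict Implicit.
Unset Printing Implicit Defensive.

Import Order.TTheory GRing.Theory Num.Theory.
Import numFieldNormedType.Exports.

Local Open Scope classical_set_scope.
Local Open Scope ring_scope.
Local Open Scope complex_scope.

(** * Moduli and logarithmic averages *)

Section modulus.
Variable R : realType.
Implicit Types z w : R[i].

Lemma sqr_modcE z : modc z ^+ 2 = complex.Re z ^+ 2 + complex.Im z ^+ 2.
Proof. by case: z => a b; rewrite /modc /= sqr_sqrtr// addr_ge0// sqr_ge0. Qed.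

Lemma modc_ge0 z : 0 <= modc z.
Proof. by case: z => a b; rewrite /modc /= sqrtr_ge0. Qed.

Lemma modc0 : modc (0 : R[i]) = 0.
Proof. exact: ComplexField.Normc.normc0. Qed.

Lemma modcM z w : modc (z * w) = modc z * modc w.
Proof. exact: ComplexField.Normc.normcM. Qed.

Lemma modcD z w : modc (z + w) <= modc z + modc w.
Proof. exact: le_normcD. Qed.

Lemma modcN z : modc (- z) = modc z.
Proof. exact: normcN. Qed.

Lemma modcB z w : modc (z - w) <= modc z + modc w.
Proof. by rewrite -(modcN w) modcD. Qed.

Lemma modcBC z w : modc (z - w) = modc (w - z).
Proof. by rewrite -modcN opprB. Qed.

Lemma modcJ z : modc z^* = modc z.
Proof. by case: z => a b; rewrite /modc /= sqrrN. Qed.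

Lemma modc_real (x : R) : modc x%:C = `|x|.
Proof. by rewrite /modc /= expr0n addr0 sqrtr_sqr. Qed.

Lemma sqr_modcD z w : modc (z + w) ^+ 2 <= 2 * modc z ^+ 2 + 2 * modc w ^+ 2.
Proof.
rewrite !sqr_modcE; case: z => a b; case: w => c d /=.
have := sqr_ge0 (a - c); have := sqr_ge0 (b - d); nra.
Qed.

(** The weights are spelt [2^-1] and [1 - 2^-1] so that the midpoint is literally an instance of
    [conv_convex]. *)
Lemma parallelogram_modc z w : modc (z - w) ^+ 2 =
  2 * modc z ^+ 2 + 2 * modc w ^+ 2
  - 4 * modc ((2^-1)%:C * z + (1 - 2^-1)%:C * w) ^+ 2.
Proof. by rewrite !sqr_modcE; case: z => a b; case: w => c d /=; field. Qed.

(** The gap between the two sides is [t (1 - t)] times the squared modulus of [z - w]. *)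
Lemma sqr_modc_convex (t : R) z w : 0 <= t <= 1 ->
  modc (t%:C * z + (1 - t)%:C * w) ^+ 2 <=
  t * modc z ^+ 2 + (1 - t) * modc w ^+ 2.
Proof.
move=> /andP[t0 t1]; rewrite !sqr_modcE; case: z => a b; case: w => c d /=.
rewrite !mul0r !subr0 !addr0 -subr_ge0.
have -> : t * (a ^+ 2 + b ^+ 2) + (1 - t) * (c ^+ 2 + d ^+ 2) -
  ((t * a + (1 - t) * c) ^+ 2 + (t * b + (1 - t) * d) ^+ 2) =
  t * (1 - t) * ((a - c) ^+ 2 + (b - d) ^+ 2) by ring.
by rewrite mulr_ge0 ?mulr_ge0 ?subr_ge0// addr_ge0 ?sqr_ge0.
Qed.

Lemma Re_le_modc z : `|complex.Re z| <= modc z.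
Proof.
rewrite -(@ler_pXn2r _ 2) ?nnegrE ?modc_ge0// sqr_modcE real_normK ?num_real//.
by rewrite lerDl sqr_ge0.
Qed.

Lemma modc_le_ReIm z : modc z <= `|complex.Re z| + `|complex.Im z|.
Proof.
rewrite -(@ler_pXn2r _ 2) ?nnegrE ?modc_ge0 ?addr_ge0//.
rewrite sqr_modcE -(real_normK (num_real (complex.Re z))).
rewrite -(real_normK (num_real (complex.Im z))).
have := mulr_ge0 (normr_ge0 (complex.Re z)) (normr_ge0 (complex.Im z)).
by rewrite sqrrD mulr2n; lra.
Qed.

End modulus.

Section logarithmic_average.
Variable R : realType.
Implicit Types (u v : int -> R) (N : nat).

Definition logsum N : R := \sum_(1 <= n < N.+1) n%:R^-1.

Lemma logsum_ge0 N : 0 <= logsum N.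
Proof. by apply: sumr_ge0 => n _; rewrite invr_ge0. Qed.

Lemma logsum_gt0 N : (0 < N)%N -> 0 < logsum N.
Proof.
case: N => // N _; rewrite /logsum big_nat_recl// invr1 ltr_pwDl//.
by apply: sumr_ge0 => n _; rewrite invr_ge0.
Qed.

Lemma le_Elog N u v : (forall n : nat, (0 < n <= N)%N -> u n%:Z <= v n%:Z) ->
  Elog N u <= Elog N v.
Proof.
move=> uv; rewrite /Elog ler_wpM2r ?invr_ge0 ?logsum_ge0//.
by apply: ler_sum_nat => n nN; rewrite ler_wpM2r ?invr_ge0 ?uv.
Qed.

Lemma eq_Elog N u v : (forall n, u n = v n) -> Elog N u = Elog N v.
Proof. by move=> uv; congr Elog; apply/funext. Qed.

Lemma ElogD N u v : Elog N (fun n => u n + v n) = Elog N u + Elog N v.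
Proof.
rewrite /Elog -mulrDl -big_split/=; congr (_ / _).
by apply: eq_bigr => n _; rewrite mulrDl.
Qed.

Lemma ElogZ N (c : R) u : Elog N (fun n => c * u n) = c * Elog N u.
Proof.
rewrite /Elog mulrA mulr_sumr; congr (_ / _).
by apply: eq_bigr => n _; rewrite mulrA.
Qed.

Lemma Elog_cst N (c : R) : (0 < N)%N -> Elog N (fun=> c) = c.
Proof.
move=> N0; rewrite /Elog -mulr_sumr mulfK// gt_eqF//; exact: logsum_gt0.
Qed.

Lemma Elog_ge0 N u : (forall n, 0 <= u n) -> 0 <= Elog N u.
Proof.
move=> u0; rewrite -[leLHS](mul0r (Elog N (fun=> 0))) -ElogZ.
by apply: le_Elog => n _; rewrite mul0r.
Qed.

Lemma Elog_le_cst N u (c : R) : (0 < N)%N -> (forall n, u n <= c) ->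
  Elog N u <= c.
Proof. by move=> N0 uc; rewrite -(Elog_cst c N0) le_Elog. Qed.

(* Abel summation: the shift costs at most [B * \sum_n (1/(n - 1) - 1/n)], which
   telescopes; the induction carries the boundary terms. *)
Lemma logsum_shift1 N u (B : R) : (forall n, 0 <= u n <= B) ->
  `|\sum_(1 <= n < N.+1) u (n%:Z + 1) / n%:R -
    \sum_(1 <= n < N.+1) u n%:Z / n%:R| <= 2 * B.
Proof.
move=> uB; have B0 : 0 <= B by case/andP: (uB 0); apply: le_trans.
pose D (N : nat) : R := \sum_(1 <= n < N.+1) u (n%:Z + 1) / n%:R -
  \sum_(1 <= n < N.+1) u n%:Z / n%:R.
suff H : u (N%:Z + 1) / N.+1%:R - B <= D N <= u (N%:Z + 1) / N.+1%:R + B - B / N.+1%:R.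
  case/andP: H => h1 h2; rewrite ler_norml -/(D N); case/andP: (uB (N%:Z + 1)) => v0 vB.
  have i0 : (0 : R) <= N.+1%:R^-1 by rewrite invr_ge0.
  have : 0 <= u (N%:Z + 1) / N.+1%:R by rewrite mulr_ge0.
  have : u (N%:Z + 1) / N.+1%:R <= B / N.+1%:R by rewrite ler_wpM2r.
  have : 0 <= B / N.+1%:R by rewrite mulr_ge0.
  move: h1 h2; move: (D N) (u _ / _) (B / _) => x y z h1 h2 k1 k2 k3.
  by apply/andP; split; lra.
elim: N => [|N].
  rewrite /D !big_geq// invr1 !mulr1 subrr.
  by case/andP: (uB (0%:Z + 1)) => ? ?; apply/andP; split; lra.
have -> : D N.+1 = D N + u (N.+1%:Z + 1) / N.+1%:R - u N.+1%:Z / N.+1%:R.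
  by rewrite /D !(@big_nat_recr _ _ _ N.+1)//=; ring.
have -> : N%:Z + 1 = N.+1%:Z by rewrite -addn1 PoszD.
case/andP => h1 h2; case/andP: (uB (N.+1%:Z + 1)) => v0 vB.
have i1 : (0 : R) <= N.+1%:R^-1 - N.+2%:R^-1.
  by rewrite subr_ge0 lef_pV2 ?posrE ?ltr0n// ler_nat.
have := mulr_ge0 v0 i1.
have : 0 <= (B - u (N.+1%:Z + 1)) * (N.+1%:R^-1 - N.+2%:R^-1).
  by rewrite mulr_ge0// subr_ge0.
move: h1 h2; rewrite mulrBl !mulrBr.
move: (D N) (u _ / _) (u _ / _) (u _ / _) (B / _) (B / _) => x y y1 y2 z z1 *.
by apply/andP; split; lra.
Qed.

Lemma Elog_shift_nat N u (B : R) (b : nat) : (forall n, 0 <= u n <= B) ->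
  `|Elog N (fun n => u (n + b%:Z)) - Elog N u| <= b%:R * (2 * B) / logsum N.
Proof.
move=> uB; elim: b => [|b IH].
  rewrite (@eq_Elog _ _ u) => [|n]; last by rewrite addr0.
  by rewrite subrr normr0 !mul0r.
pose v (n : int) := u (n + b%:Z).
have -> : Elog N (fun n => u (n + b.+1%:Z)) - Elog N u =
  (Elog N (fun n => v (n + 1)) - Elog N v) + (Elog N v - Elog N u).
  rewrite addrA subrK; congr (_ - _); apply: eq_Elog => n.
  by rewrite /v -addrA -PoszD.
apply: (le_trans (ler_normD _ _)).
rewrite -natr1 2!mulrDl [leRHS]addrC mul1r lerD//.
have L0 : 0 <= (logsum N)^-1 :> R by rewrite invr_ge0 logsum_ge0.
rewrite /Elog -mulrBl normrM [X in _ * X]ger0_norm ?L0//.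
apply: ler_wpM2r => //; apply: logsum_shift1 => n; exact: uB.
Qed.

Lemma Elog_shift N u (B : R) (b : int) : (forall n, 0 <= u n <= B) ->
  `|Elog N (fun n => u (n + b)) - Elog N u| <= `|b|%N%:R * (2 * B) / logsum N.
Proof.
move=> uB; case: (intP b) => [|c|c].
- exact: Elog_shift_nat 0%N uB.
- exact: Elog_shift_nat c.+1 uB.
(* Moving [u] backwards amounts to moving [v] forwards, which reduces this case to
   [Elog_shift_nat]. *)
pose v (n : int) := u (n - c.+1%:Z).
rewrite distrC abszN absz_nat.
have -> : Elog N u = Elog N (fun n => v (n + c.+1%:Z)).
  by apply: eq_Elog => n; rewrite /v addrK.
by apply: (@Elog_shift_nat _ v) => n; exact: uB.
Qed.

End logarithmic_average.

(** * Convex combinations of shifts *)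

Section convex_operators.
Variable R : realType.
Implicit Types (f g : int -> R[i]) (U V : (int -> R[i]) -> int -> R[i]).
Implicit Types (q b : int) (N H : nat) (B : R).

Definition sup_le f B := forall n, modc (f n) <= B.

Definition sqavg N f : R := Elog N (fun n => modc (f n) ^+ 2).

Definition avg q H f (n : int) : R[i] :=
  Eavg H (fun h => f (n + q * h%:Z)).

(** Given by closure rules, without explicit weights, so that properties of these operators follow
    by induction. Composition is a rule because near-minimisers get composed. *)
Inductive conv q : ((int -> R[i]) -> int -> R[i]) -> Prop :=
| conv_shift b : (q %| b)%Z -> conv q (fun f n => f (n + b))
| conv_comp U V : conv q U -> conv q V -> conv q (fun f => U (V f))
| conv_convex (t : R) U V : 0 <= t <= 1 -> conv q U -> conv q V ->
    conv q (fun f n => t%:C * U f n + (1 - t)%:C * V f n).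

Lemma sup_le_ge0 f B : sup_le f B -> 0 <= B.
Proof. by move/(_ 0); apply: le_trans; exact: modc_ge0. Qed.

Lemma sup_le_sqr f B : sup_le f B -> forall n, 0 <= modc (f n) ^+ 2 <= B ^+ 2.
Proof.
move=> fB n; have B0 := sup_le_ge0 fB.
by rewrite sqr_ge0 ler_pXn2r ?nnegrE ?modc_ge0 ?fB.
Qed.

Lemma sqavg_ge0 N f : 0 <= sqavg N f.
Proof. by apply: Elog_ge0 => n; rewrite sqr_ge0. Qed.

Lemma sqavg_le_sup N f B : (0 < N)%N -> sup_le f B -> sqavg N f <= B ^+ 2.
Proof. by move=> N0 /sup_le_sqr fB; apply: Elog_le_cst => // n; case/andP: (fB n). Qed.

Lemma sqavgD N f g :
  sqavg N (fun n => f n + g n) <= 2 * sqavg N f + 2 * sqavg N g.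
Proof.
rewrite /sqavg -!ElogZ -ElogD; apply: le_Elog => n _; exact: sqr_modcD.
Qed.

Lemma sqavgBC N f g :
  sqavg N (fun n => f n - g n) = sqavg N (fun n => g n - f n).
Proof. by apply: eq_Elog => n; rewrite modcBC. Qed.

Lemma sqavgB_trans N f g h : sqavg N (fun n => f n - h n) <=
  2 * sqavg N (fun n => f n - g n) + 2 * sqavg N (fun n => g n - h n).
Proof.
apply: le_trans (sqavgD _ _ _).
by rewrite le_eqVlt; apply/orP; left; apply/eqP/eq_Elog => n; rewrite addrA subrK.
Qed.

Lemma conv_lin q U : conv q U -> forall (a b : R[i]) f g,
  U (fun n => a * f n + b * g n) = fun n => a * U f n + b * U g n.
Proof.
elim=> [//|{}U V _ IHU _ IHV|t {}U V _ _ IHU _ IHV] a b f g.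
  by rewrite IHV IHU.
by apply/funext => n; rewrite IHU IHV; ring.
Qed.

Lemma convB q U : conv q U -> forall f g,
  U (fun n => f n - g n) = fun n => U f n - U g n.
Proof.
move=> cU f g; have := conv_lin cU 1 (-1) f g.
have H h k : (fun n : int => 1 * h n + -1 * k n) = (fun n => h n - k n) :> (int -> R[i]).
  by apply/funext => n; rewrite mul1r mulN1r.
by rewrite !H.
Qed.

Lemma conv_sup_le q U : conv q U -> forall f B, sup_le f B -> sup_le (U f) B.
Proof.
elim=> [b _|{}U V _ IHU _ IHV|t {}U V /andP[t0 t1] _ IHU _ IHV] f B fB.
- by move=> n; exact: fB.
- exact/IHU/IHV.
move=> n; apply: (le_trans (modcD _ _)); rewrite !modcM !modc_real.
rewrite !ger0_norm ?subr_ge0//.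
have -> : B = t * B + (1 - t) * B by ring.
by rewrite lerD// ler_wpM2l ?subr_ge0//; [exact: IHU|exact: IHV].
Qed.

Lemma conv_itv q U : conv q U -> forall f (a b : R),
  takes_values_in_itv a b f -> takes_values_in_itv a b (U f).
Proof.
elim=> [c _|{}U V _ IHU _ IHV|t {}U V /andP[t0 t1] _ IHU _ IHV] f a b fab.
- by move=> _ [n _ <-]; apply: fab; exists (n + c).
- exact/IHU/IHV.
move=> _ [n _ <-].
have [x xab <-] := IHU f a b fab _ (imageT _ n).
have [y yab <-] := IHV f a b fab _ (imageT _ n).
exists (t * x + (1 - t) * y); last by rewrite rmorphD !rmorphM.
move: xab yab; rewrite /= !in_itv/= => /andP[ax xb] /andP[ay yb].
have := mulr_ge0 t0 (_ : 0 <= x - a); rewrite subr_ge0 => /(_ ax).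
have := mulr_ge0 t0 (_ : 0 <= b - x); rewrite subr_ge0 => /(_ xb).
have s0 : 0 <= 1 - t by rewrite subr_ge0.
have := mulr_ge0 s0 (_ : 0 <= y - a); rewrite subr_ge0 => /(_ ay).
have := mulr_ge0 s0 (_ : 0 <= b - y); rewrite subr_ge0 => /(_ yb).
by move=> *; apply/andP; split; lra.
Qed.

Lemma conv_commute_shift q U : conv q U -> forall f b,
  U (fun n => f (n + b)) = fun n => U f (n + b).
Proof.
elim=> [c _|{}U V _ IHU _ IHV|t {}U V _ _ IHU _ IHV] f b.
- by apply/funext => n; rewrite addrAC.
- by rewrite IHV IHU.
- by rewrite IHU IHV.
Qed.

(** These operators behave like polynomials in a single shift, so they commute. *)
Lemma conv_commute q r U V : conv q U -> conv r V -> forall f,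
  U (V f) = V (U f).
Proof.
move=> cU cV f; elim: cU f => [c _|U1 U2 _ IH1 _ IH2|t U1 U2 _ _ IH1 _ IH2] f.
- by rewrite (conv_commute_shift cV).
- by rewrite IH2 IH1.
- by rewrite (conv_lin cV) IH1 IH2.
Qed.

Lemma conv_dvd q r U : (q %| r)%Z -> conv r U -> conv q U.
Proof.
move=> qr; elim=> [b rb|{}U V _ IHU _ IHV|t {}U V t01 _ IHU _ IHV].
- by apply: conv_shift; exact: dvdz_trans rb.
- exact: conv_comp.
- exact: conv_convex.
Qed.

Lemma conv_mem (A : set (int -> R[i])) q U :
  Cstar_subalgebra A -> translation_invariant A -> conv q U ->
  forall f, A f -> A (U f).
Proof.
move=> CA TA; elim=> [b _|{}U V _ IHU _ IHV|t {}U V _ _ IHU _ IHV] f Af.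
- exact: TA.
- exact/IHU/IHV.
- by apply: Cstar_lin => //; [exact: IHU|exact: IHV].
Qed.

Lemma sqavg_shift N f B b : sup_le f B ->
  sqavg N (fun n => f (n + b)) <=
  sqavg N f + `|b|%N%:R * (2 * B ^+ 2) / logsum R N.
Proof.
move=> /sup_le_sqr fB; rewrite addrC -lerBlDr; apply: le_trans (Elog_shift N b fB).
exact: ler_norm.
Qed.

(** A shift preserves [sqavg] only up to a boundary error, and the errors accumulate along the
    structure of [U]. Since [C] depends on [U] alone, a single [kappa] can later serve all
    functions. *)
Lemma conv_sqavg q U : conv q U -> exists2 C : R, 0 <= C &
  forall f B N, (0 < N)%N -> sup_le f B ->
    sqavg N (U f) <= sqavg N f + C * B ^+ 2 / logsum R N.
Proof.
elim=> [b _|{}U V cU [C C0 IHU] cV [D D0 IHV]|t {}U V t01 _ [C C0 IHU] _ [D D0 IHV]].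
- exists (`|b|%N%:R * 2); first by rewrite mulr_ge0.
  by move=> f B N _ fB; rewrite -(mulrA _ 2); exact: sqavg_shift.
- exists (C + D); first by rewrite addr_ge0.
  move=> f B N N0 fB; apply: (le_trans (IHU _ B _ N0 (conv_sup_le cV fB))).
  rewrite 2!mulrDl; have := IHV f B N N0 fB.
  by move: (C * _ / _) (D * _ / _) => x y; lra.
- exists (C + D); first by rewrite addr_ge0.
  move=> f B N N0 fB.
  have := IHU f B N N0 fB; have := IHV f B N N0 fB.
  have : sqavg N (fun n => t%:C * U f n + (1 - t)%:C * V f n) <=
     t * sqavg N (U f) + (1 - t) * sqavg N (V f).
    rewrite /sqavg -!ElogZ -ElogD; apply: le_Elog => n _.
    exact: sqr_modc_convex.
  have e (x : R) : 0 <= x -> 0 <= x * B ^+ 2 / logsum R N.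
    by move=> x0; rewrite mulr_ge0 ?invr_ge0 ?logsum_ge0// mulr_ge0 ?sqr_ge0.
  have e0 := e C C0; have e1 := e D D0.
  rewrite !mulrDl.
  move: e0 e1; clear e; move: (C * _ / _) (D * _ / _) => c d c0 d0 h hV hU.
  apply: (le_trans h); case/andP: t01 => t0 t1.
  have := ler_wpM2l t0 hU.
  have := mulr_ge0 t0 d0.
  have s0 : 0 <= 1 - t by rewrite subr_ge0.
  have := mulr_ge0 s0 c0.
  have := ler_wpM2l s0 hV.
  by move=> *; lra.
Qed.

Lemma avgD q H f g n :
  avg q H (fun n => f n + g n) n = avg q H f n + avg q H g n.
Proof. by rewrite /avg /Eavg big_split mulrDl. Qed.

Lemma avgN q H f n : avg q H (fun n => - f n) n = - avg q H f n.
Proof. by rewrite /avg /Eavg sumrN mulNr. Qed.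

Lemma avgZ q H (a : R[i]) f n :
  avg q H (fun n => a * f n) n = a * avg q H f n.
Proof. by rewrite /avg /Eavg -mulr_sumr mulrA. Qed.

(** The average of [H + 2] terms mixes that of the first [H + 1], with weight [t], and one further
    shift. The index [H.+1] excludes the empty average, which is 0. *)
Lemma conv_avg q H : conv q (avg q H.+1).
Proof.
elim: H => [|H IH].
  have -> : avg q 1 = fun f n => f (n + q).
    apply/funext => f; apply/funext => n.
    by rewrite /avg /Eavg big_nat1 divr1 mulr1.
  by apply: conv_shift; exact: dvdzz.
pose t : R := H.+1%:R / H.+2%:R.
have tE : t%:C = H.+1%:R / H.+2%:R by rewrite /t rmorphM/= fmorphV/= !rmorph_nat.
have h1 : H.+1%:R != 0 :> R[i] by rewrite pnatr_eq0.
have h2 : H.+2%:R != 0 :> R[i] by rewrite pnatr_eq0.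
have t'E : (1 - t)%:C = H.+2%:R^-1.
  rewrite rmorphB/= rmorph1 tE -{1}(divff h2) -mulrBl -natrB//.
  by rewrite subSnn mul1r.
have -> : avg q H.+2 = fun f n =>
    t%:C * avg q H.+1 f n + (1 - t)%:C * f (n + q * H.+2%:Z).
  apply/funext => f; apply/funext => n.
  rewrite /avg /Eavg big_nat_recr//= tE t'E.
  move: (H.+1%:R) (H.+2%:R) h1 h2 (\sum_(1 <= _ < _) _) (f _) => x y x0 y0 u v.
  by field; rewrite x0 y0.
apply: conv_convex => //.
  by rewrite divr_ge0//= ler_pdivrMr ?ltr0n// mul1r ler_nat.
by apply: conv_shift; exact: dvdz_mulr.
Qed.

Lemma avg_sub_shift1 q H f B n : (0 < H)%N -> sup_le f B ->
  modc (avg q H (fun n => f n - f (n + q)) n) <= 2 * B / H%:R.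
Proof.
move=> H0 fB; rewrite /avg /Eavg.
have -> : \sum_(1 <= h < H.+1) (f (n + q * h%:Z) - f (n + q * h%:Z + q)) =
    f (n + q) - f (n + q * H.+1%:Z).
  pose F (h : nat) := - f (n + q * h%:Z).
  rewrite (eq_bigr (fun h : nat => F h.+1 - F h)) => [|h _].
    by rewrite telescope_sumr// /F opprK mulr1 addrC.
  by rewrite /F opprK addrC -addrA -addn1 PoszD mulrDr mulr1.
rewrite modcM.
have -> : modc (H%:R^-1 : R[i]) = H%:R^-1.
  by rewrite -(rmorph_nat (@real_complex R)) -fmorphV modc_real ger0_norm ?invr_ge0.
rewrite ler_wpM2r ?invr_ge0//; apply: (le_trans (modcB _ _)).
by rewrite mulr2n mulrDl mul1r lerD.
Qed.

Lemma avg_sub_shift q (c : nat) H f B n : (0 < H)%N -> sup_le f B ->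
  modc (avg q H (fun n => f n - f (n + q * c%:Z)) n) <= c%:R * (2 * B) / H%:R.
Proof.
move=> H0 fB; elim: c => [|c IH].
  rewrite (_ : (fun n => _) = fun=> 0); last by apply/funext => m; rewrite mulr0 addr0 subrr.
  by rewrite /avg /Eavg big1// mul0r modc0 !mul0r.
pose g (n : int) := f (n + q * c%:Z).
rewrite (_ : (fun n => _) = (fun n => (f n - g n) + (g n - g (n + q)))); last first.
  apply/funext => m; rewrite addrA subrK /g; congr (_ - f _).
  by rewrite -addrA -{2}(mulr1 q) -mulrDr -addn1 PoszD [1 + _]addrC.
rewrite avgD; apply: (le_trans (modcD _ _)).
rewrite -natr1 2!mulrDl mul1r lerD//; apply: avg_sub_shift1 => // m; exact: fB.
Qed.

(** For a shift by a multiple of [q] the averages telescope to boundary terms. A composition is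
    handled by splitting [f - U (V f)] as [(f - V f) + (V f - U (V f))]. *)
Lemma avg_sub_conv q U : conv q U -> exists2 C : R, 0 <= C &
  forall f B H n, (0 < H)%N -> sup_le f B ->
    modc (avg q H (fun n => f n - U f n) n) <= C * B / H%:R.
Proof.
elim=> [b /dvdzP[c ->]|{}U V cU [C C0 IHU] cV [D D0 IHV]|
        t {}U V /andP[t0 t1] _ [C C0 IHU] _ [D D0 IHV]].
- exists (`|c|%N%:R * 2); first by rewrite mulr_ge0.
  move=> f B H n H0 fB; rewrite -(mulrA _ 2) (mulrC c).
  case: (intP c) => [|d|d].
  + exact: (@avg_sub_shift q 0%N).
  + exact: avg_sub_shift.
  pose g (m : int) := f (m - q * d.+1%:Z).
  rewrite (_ : (fun n => _) = (fun n => - (g n - g (n + q * d.+1%:Z)))); last first.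
    by apply/funext => m; rewrite /g opprB addrK mulrN.
  rewrite avgN modcN abszN absz_nat; apply: avg_sub_shift => // m; exact: fB.
- exists (D + C); first by rewrite addr_ge0.
  move=> f B H n H0 fB.
  rewrite (_ : (fun n => _) = (fun n => (f n - V f n) + (V f n - U (V f) n))); last first.
    by apply/funext => m; rewrite addrA subrK.
  rewrite avgD; apply: (le_trans (modcD _ _)).
  rewrite 2!mulrDl lerD//; [exact: IHV|apply: IHU => //; exact: (conv_sup_le cV)].
- exists (C + D); first by rewrite addr_ge0.
  move=> f B H n H0 fB.
  rewrite (_ : (fun n => _) = 
    (fun n => t%:C * (f n - U f n) + (1 - t)%:C * (f n - V f n))); last first.
    by apply/funext => m; rewrite rmorphB rmorph1; ring.
  rewrite avgD !avgZ; apply: (le_trans (modcD _ _)).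
  rewrite (modcM t%:C) (modcM (1 - t)%:C) !modc_real !ger0_norm ?subr_ge0//.
  rewrite [(C + D) * _]mulrDl [leRHS]mulrDl lerD//.
    apply: le_trans (IHU f B H n H0 fB); rewrite -[leRHS]mul1r.
    by rewrite ler_wpM2r// modc_ge0.
  apply: le_trans (IHV f B H n H0 fB); rewrite -[leRHS]mul1r.
  by rewrite ler_wpM2r ?modc_ge0// gerBl.
Qed.

End convex_operators.

(** * Complex convergence through real and imaginary parts *)

Section complex_convergence.
Variable R : realType.
Implicit Types (f : int -> R[i]) (z : R[i]).

Lemma normc_modc z : `|z| = (modc z)%:C.
Proof. by case: z. Qed.

Lemma Re_mulr_real z (r : R) : complex.Re (z * r%:C) = complex.Re z * r.
Proof. by case: z => a b /=; rewrite mulr0 subr0. Qed.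

Lemma Im_mulr_real z (r : R) : complex.Im (z * r%:C) = complex.Im z * r.
Proof. by case: z => a b /=; rewrite mulr0 add0r. Qed.

Lemma invr_nat_complex n : n%:R^-1 = (n%:R^-1)%:C :> R[i].
Proof. by rewrite fmorphV rmorph_nat. Qed.

Lemma logsum_complex N :
  \sum_(1 <= n < N.+1) n%:R^-1 = (logsum R N)%:C :> R[i].
Proof.
by rewrite /logsum rmorph_sum; apply: eq_bigr => n _; exact: invr_nat_complex.
Qed.

Lemma Re_Elog N f : complex.Re (Elog N f) = Elog N (fun n => complex.Re (f n)).
Proof.
rewrite /Elog logsum_complex -fmorphV Re_mulr_real; congr (_ * _).
rewrite (big_morph (@complex.Re _) (id1 := 0) (op1 := +%R))//; last by case=> ? ? [].
by apply: eq_bigr => n _; rewrite invr_nat_complex Re_mulr_real.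
Qed.

Lemma Im_Elog N f : complex.Im (Elog N f) = Elog N (fun n => complex.Im (f n)).
Proof.
rewrite /Elog logsum_complex -fmorphV Im_mulr_real; congr (_ * _).
rewrite (big_morph (@complex.Im _) (id1 := 0) (op1 := +%R))//; last by case=> ? ? [].
by apply: eq_bigr => n _; rewrite invr_nat_complex Im_mulr_real.
Qed.

Lemma eq_is_cvgn (K : numFieldType) (u v : nat -> K) :
  (forall s, u s = v s) -> cvg (u @ \oo) -> cvg (v @ \oo).
Proof. by move=> uv; have -> : v = u by apply/funext. Qed.

Lemma is_cvg_Re (z : nat -> (R[i] : numFieldType)) : cvg (z @ \oo) ->
  cvg ((fun s => complex.Re (z s)) @ \oo).
Proof.
move=> /cvg_ex[l /cvgrPdist_le zl]; apply/cvg_ex; exists (complex.Re l).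
apply/cvgrPdist_le => e e0.
have ec0 : 0 < e%:C :> R[i] by rewrite ltcR.
apply: filterS (zl _ ec0) => s; rewrite normc_modc lecR; apply: le_trans.
by have := Re_le_modc (l - z s); case: (l) (z s) => ? ? [].
Qed.

Lemma is_cvg_complex (z : nat -> (R[i] : numFieldType)) :
  cvg ((fun s => complex.Re (z s)) @ \oo) ->
  cvg ((fun s => complex.Im (z s)) @ \oo) -> cvg (z @ \oo).
Proof.
move=> /cvg_ex[a /cvgrPdist_le za] /cvg_ex[b /cvgrPdist_le zb].
apply/cvg_ex; exists (a +i* b)%C; apply/cvgrPdist_le => -[e e'].
(* A positive element of [R[i]] has zero imaginary part, so the tolerance is real. *)
rewrite ltcE/= => /andP[/eqP -> e0].
have e20 : 0 < e / 2 by rewrite divr_gt0.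
apply: filterS2 (za _ e20) (zb _ e20) => s h1 h2.
rewrite normc_modc lecR; apply: (le_trans (modc_le_ReIm _)).
rewrite (splitr e); case: (z s) h1 h2 => ? ? /= h1 h2; exact: lerD.
Qed.

End complex_convergence.

(** * The mean square closure of A *)

Section mean_square_closure.
Variables (R : realType) (Ns : nat -> nat).
Hypothesis Ns_gt0 : (0 < Ns 0)%N.
Hypothesis Ns_incr : forall s : nat, (Ns s < Ns s.+1)%N.
Implicit Types (f g h : int -> R[i]) (U : (int -> R[i]) -> int -> R[i]).
Implicit Types (e a B : R).

Lemma ltn_Ns s t : (Ns s < Ns t)%N = (s < t)%N.
Proof. by apply: leqW_mono; apply: leq_mono; apply: homo_ltn => //; exact: ltn_trans. Qed.

Lemma leq_Ns s : (s < Ns s)%N.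
Proof. by elim: s => // s IH; exact: leq_ltn_trans (Ns_incr s). Qed.

Lemma Ns_pos s : (0 < Ns s)%N.
Proof. exact: leq_ltn_trans (leq_Ns s). Qed.

Lemma logsum_nd : {homo logsum R : m n / (m <= n)%N >-> m <= n}.
Proof.
apply: homo_leq => [//||N]; first by move=> ? ? ?; exact: le_trans.
by rewrite /logsum [leRHS]big_nat_recr//= lerDl invr_ge0.
Qed.

(** The harmonic series diverges and [Ns s] exceeds [s]; hence shift errors of order [1 / logsum]
    vanish along the scales. *)
Lemma logsum_near a : \forall s \near \oo, a <= logsum R (Ns s).
Proof.
have [[N aN]|nE] := pselect (exists N, a <= logsum R N).
  exists N => // s /= Ns'; apply: (le_trans aN); apply: logsum_nd.
  exact: leq_trans Ns' (ltnW (leq_Ns s)).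
exfalso; apply: (@dvg_harmonic R).
have E : series (@harmonic R) = logsum R.
  by apply/funext => N; rewrite /series/= /logsum big_add1.
rewrite E; apply: nondecreasing_is_cvgn; first exact: logsum_nd.
exists a => _ [N _ <-]; apply/ltW; rewrite ltNge; apply/negP => aN.
by apply: nE; exists N.
Qed.

Lemma div_logsum_near a e : 0 < e -> \forall s \near \oo, a / logsum R (Ns s) <= e.
Proof.
move=> e0; apply: filterS (logsum_near (a / e)) => s.
by rewrite ler_pdivrMr// ler_pdivrMr ?logsum_gt0 ?Ns_pos// mulrC.
Qed.

(** An eventual bound makes sense before the averages are known to converge, as is the case for
    glued functions. *)
Definition msq_le f e := \forall s \near \oo, sqavg (Ns s) f <= e.

Lemma msq_leW f e e' : e <= e' -> msq_le f e -> msq_le f e'.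
Proof. by move=> ee'; apply: filterS => s /le_trans; apply. Qed.

Lemma msq_le_trans f g h a e : msq_le (fun n => f n - g n) a ->
  msq_le (fun n => g n - h n) e -> msq_le (fun n => f n - h n) (2 * a + 2 * e).
Proof.
apply: filterS2 => s h1 h2; apply: (le_trans (sqavgB_trans (Ns s) f g h)).
by rewrite lerD// ler_wpM2l.
Qed.

Lemma msq_leC f g e : msq_le (fun n => f n - g n) e -> msq_le (fun n => g n - f n) e.
Proof. by apply: filterS => s; rewrite sqavgBC. Qed.

Lemma msq_le_sup f B : sup_le f B -> msq_le f (B ^+ 2).
Proof. by move=> fB; apply: nearW => s; apply: sqavg_le_sup => //; exact: Ns_pos. Qed.

Lemma msq_le_conv q U f B a e : conv q U -> sup_le f B -> 0 < e ->
  msq_le f a -> msq_le (U f) (a + e).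
Proof.
move=> /conv_sqavg[C C0 UC] fB e0.
apply: filterS2 (div_logsum_near (C * B ^+ 2) e0) => s h1 h2.
by apply: (le_trans (UC f B _ (Ns_pos s) fB)); exact: lerD.
Qed.

(** Cauchy-Schwarz without roots: average [2 e u <= e^2 + u^2]. *)
Lemma Elog_le_sqr N (u : int -> R) e : (0 < N)%N -> 0 < e ->
  Elog N (fun n => u n ^+ 2) <= e ^+ 2 -> Elog N u <= e.
Proof.
move=> N0 e0 h; rewrite -(ler_pM2l e0) -(ler_pM2l (@ltr0n _ 2)).
rewrite -!ElogZ.
apply: (@le_trans _ _ (Elog N (fun n => e ^+ 2 + u n ^+ 2))).
  by apply: le_Elog => n _; have := sqr_ge0 (e - u n%:Z); nra.
by rewrite ElogD (Elog_cst _ N0); nra.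
Qed.

Lemma Elog_Re_dist N f g e : (0 < N)%N -> 0 < e ->
  sqavg N (fun n => f n - g n) <= e ^+ 2 ->
  `|Elog N (fun n => complex.Re (f n)) - Elog N (fun n => complex.Re (g n))| <= e.
Proof.
move=> N0 e0 h.
have E : Elog N (fun n => complex.Re (f n)) - Elog N (fun n => complex.Re (g n)) =
    Elog N (fun n => complex.Re (f n - g n)).
  rewrite -[in X in _ - X](mulr1 (Elog _ _)) mulrC -mulNr -ElogZ -ElogD.
  by apply: eq_Elog => n; case: (f n) (g n) => a b [c d] /=; rewrite mulN1r.
have le_sq (z : R[i]) : complex.Re z ^+ 2 <= modc z ^+ 2 by rewrite sqr_modcE lerDl sqr_ge0.
rewrite E ler_norml; apply/andP; split.
  rewrite lerNl -mulN1r -ElogZ; apply: Elog_le_sqr => //.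
  apply: le_trans h; apply: le_Elog => n _.
  by rewrite mulN1r sqrrN.
apply: Elog_le_sqr => //; apply: le_trans h; exact: le_Elog.
Qed.

Variable A : set (int -> R[i]).
Hypothesis CA : Cstar_subalgebra A.
Hypothesis TA : translation_invariant A.
Hypothesis EA : admits_Elog Ns A.

(** The sup bound on [f] is kept because products and shifts are controlled in mean square only for
    bounded functions; the approximants need no common bound. *)
Definition msq_closure f := (exists B, sup_le f B) /\
  forall e, 0 < e -> exists2 g, A g & msq_le (fun n => f n - g n) e.

Lemma Cstar_bounded f : A f -> exists B, sup_le f B.
Proof. by move/(Cstar_linfty CA). Qed.

Lemma msq_le0 e : 0 <= e -> msq_le (fun=> 0) e.
Proof.
move=> e0; apply: nearW => s; rewrite /sqavg modc0 expr0n/=.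
by rewrite Elog_cst// Ns_pos.
Qed.

Lemma mem_msq_closure f : A f -> msq_closure f.
Proof.
move=> Af; split; first exact: Cstar_bounded.
move=> e e0; exists f => //; rewrite (_ : (fun n => _) = fun=> 0).
  exact/msq_le0/ltW.
by apply/funext => n; rewrite subrr.
Qed.

Lemma msq_leM f g B a : sup_le g B -> msq_le f a ->
  msq_le (fun n => g n * f n) (B ^+ 2 * a).
Proof.
move=> /sup_le_sqr gB; apply: filterS => s h; rewrite /sqavg.
apply: (@le_trans _ _ (Elog (Ns s) (fun n => B ^+ 2 * modc (f n) ^+ 2))).
  apply: le_Elog => n _; rewrite modcM exprMn ler_wpM2r ?sqr_ge0//.
  by case/andP: (gB n%:Z).
by rewrite ElogZ ler_wpM2l ?sqr_ge0.
Qed.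

Lemma msq_leD f g a e : msq_le f a -> msq_le g e ->
  msq_le (fun n => f n + g n) (2 * a + 2 * e).
Proof.
apply: filterS2 => s h1 h2; apply: (le_trans (sqavgD (Ns s) f g)).
by rewrite lerD// ler_wpM2l.
Qed.

Lemma small_mul (c e : R) : 0 <= c -> 0 < e -> exists2 d, 0 < d & c * d <= e.
Proof.
move=> c0 e0; have c1 : 0 < c + 1 by rewrite ltr_wpDl.
exists (e / (c + 1)); first by rewrite divr_gt0.
by rewrite mulrCA -[leRHS]mulr1 ler_pM2l// ler_pdivrMr// mul1r lerDl.
Qed.

Lemma small_sqr e : 0 < e -> exists2 b, 0 < b & b ^+ 2 <= e.
Proof.
move=> e0; exists (Num.min 1 e); first by rewrite lt_min ltr01.
apply: (@le_trans _ _ (Num.min 1 e)); last by rewrite ge_min lexx orbT.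
by rewrite expr2 ler_piMl ?le_min ?ler01 ?(ltW e0)// ge_min lexx.
Qed.

Lemma msq_closure_add f g : msq_closure f -> msq_closure g ->
  msq_closure (fun n => f n + g n).
Proof.
move=> [[B fB] fA] [[D gD] gA]; split.
  by exists (B + D) => n; apply: (le_trans (modcD _ _)); exact: lerD.
move=> e e0; have e4 : 0 < e / 4 by rewrite divr_gt0.
have [f' Af' hf] := fA _ e4; have [g' Ag' hg] := gA _ e4.
exists (fun n => 1 * f' n + 1 * g' n); first exact: (Cstar_lin CA).
have := msq_leD hf hg; have -> : 2 * (e / 4) + 2 * (e / 4) = e by field.
congr msq_le; apply/funext => n /=; ring.
Qed.

(** Write [f g - f' g'] as [f (g - g') + g' (f - f')]. The order of choice matters: [f'] is picked
    after [g'], with a precision depending on the bound of [g']. *)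
Lemma msq_closure_mul f g : msq_closure f -> msq_closure g ->
  msq_closure (fun n => f n * g n).
Proof.
move=> [[B fB] fA] [[D gD] gA]; split.
  by exists (B * D) => n; rewrite modcM ler_pM ?modc_ge0.
move=> e e0; have e4 : 0 < e / 4 by rewrite divr_gt0.
have [d d0 Bd] := small_mul (sqr_ge0 B) e4.
have [g' Ag' hg] := gA _ d0; have [D' gD'] := Cstar_bounded Ag'.
have [d' d'0 Dd'] := small_mul (sqr_ge0 D') e4.
have [f' Af' hf] := fA _ d'0.
exists (fun n => f' n * g' n); first exact: (Cstar_mul CA).
have h1 := msq_leW Bd (msq_leM fB hg); have h2 := msq_leW Dd' (msq_leM gD' hf).
have := msq_leD h1 h2; have -> : 2 * (e / 4) + 2 * (e / 4) = e by field.
congr msq_le; apply/funext => n /=; ring.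
Qed.

Lemma msq_closure_conj f : msq_closure f -> msq_closure (fun n => (f n)^*).
Proof.
move=> [[B fB] fA]; split; first by exists B => n; rewrite modcJ.
move=> e /fA[g Ag hg]; exists (fun n => (g n)^*); first exact: (Cstar_conj CA).
apply: filterS hg => s; congr (_ <= _).
by apply: eq_Elog => n; rewrite -rmorphB modcJ.
Qed.

Lemma msq_closure_conv q U f : conv q U -> msq_closure f -> msq_closure (U f).
Proof.
move=> cU [[B fB] fA]; split; first by exists B; exact: (conv_sup_le cU).
move=> e e0; have e2 : 0 < e / 2 by rewrite divr_gt0.
have [g Ag hg] := fA _ e2; have [D gD] := Cstar_bounded Ag.
exists (U g); first exact: (conv_mem CA TA cU).
have fgB : sup_le (fun n => f n - g n) (B + D).
  by move=> n; apply: (le_trans (modcB _ _)); exact: lerD.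
by have := msq_le_conv cU fgB e2 hg; rewrite -splitr (convB cU).
Qed.

Lemma msq_closure_cst (c : R[i]) : msq_closure (fun=> c).
Proof.
apply: mem_msq_closure.
rewrite (_ : (fun=> c) = (fun n => c * 1 + 0 * 1)).
  by apply: (Cstar_lin CA); exact: (Cstar_one CA).
by apply/funext => n; rewrite mulr1 mul0r addr0.
Qed.

Lemma msq_closure_sub f g : msq_closure f -> msq_closure g ->
  msq_closure (fun n => f n - g n).
Proof.
move=> cf cg; have := msq_closure_add cf (msq_closure_mul (msq_closure_cst (-1)) cg).
by congr msq_closure; apply/funext => n; rewrite mulN1r.
Qed.

(** The averages stay eventually within [e / 3] of a convergent sequence coming from [A], hence are
    Cauchy; thirds leave room for a strict inequality. *)
Lemma is_cvg_Elog_Re f : msq_closure f ->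
  cvg ((fun s => Elog (Ns s) (fun n => complex.Re (f n))) @ \oo).
Proof.
move=> [_ fA]; apply/cauchy_cvgP/cauchy_exP => e e0.
have e20 : 0 < e / 3 by rewrite divr_gt0.
have [g Ag hg] := fA _ (exprn_gt0 2 e20).
have : cvg ((fun s => Elog (Ns s) (fun n => complex.Re (g n))) @ \oo).
  by apply: eq_is_cvgn (is_cvg_Re (EA Ag)) => s; exact: Re_Elog.
move=> /cvg_ex[l /cvgrPdist_le gl]; exists l.
suff : \forall s \near \oo, ball l e (Elog (Ns s) (fun n => complex.Re (f n))) by [].
apply: filterS2 (gl _ e20) hg => s h1 h2; rewrite -ball_normE /ball_/=.
have := Elog_Re_dist (Ns_pos s) e20 h2; rewrite distrC => h3.
apply: (le_lt_trans (ler_distD (Elog (Ns s) (fun n => complex.Re (g n))) _ _)).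
by apply: (le_lt_trans (lerD h1 h3)); lra.
Qed.

Lemma msq_closure_has_Elog f : msq_closure f -> has_Elog Ns f.
Proof.
move=> cf; apply: is_cvg_complex.
  by apply: eq_is_cvgn (is_cvg_Elog_Re cf) => s; rewrite Re_Elog.
(* The imaginary part of [f] is the real part of [- 'i * f]. *)
apply: eq_is_cvgn (is_cvg_Elog_Re (msq_closure_mul (msq_closure_cst (- 'i)) cf)) => s.
rewrite Im_Elog; apply: eq_Elog => n.
by case: (f n) => a b /=; ring.
Qed.

(** The functional Q, written with [Eloglim] so that it unfolds to the quantities in
    [locally_aperiodic] and [locally_quasiperiodic]. *)
Definition msq f : R := Eloglim Ns (fun n => modc (f n) ^+ 2).

(** The squared modulus is the real part of [f] times its conjugate, which stays in the closure. *)
Lemma is_cvg_msq f : msq_closure f -> cvg ((fun s => sqavg (Ns s) f) @ \oo).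
Proof.
move=> cf.
apply: eq_is_cvgn (is_cvg_Elog_Re (msq_closure_mul cf (msq_closure_conj cf))) => s.
apply: eq_Elog => n.
by rewrite sqr_modcE; case: (f n) => a b /=; ring.
Qed.

Lemma msq_le_msq f e : msq_closure f -> msq_le f e -> msq f <= e.
Proof. by move=> /is_cvg_msq cf fe; exact: limr_le. Qed.

Lemma msq_ge0 f : msq_closure f -> 0 <= msq f.
Proof. by move=> /is_cvg_msq cf; apply: limr_ge => //; apply: nearW => s; exact: sqavg_ge0. Qed.

Lemma msq_le_near f e : msq_closure f -> 0 < e -> msq_le f (msq f + e).
Proof.
move=> /is_cvg_msq cf e0.
move/cvgrPdist_le: (cf) => /(_ e e0); apply: filterS => s /=.
by rewrite distrC => /ler_normlP[_]; rewrite -lerBlDl.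
Qed.

(** * Gluing along a slow index *)

Lemma inv_nat_near (c e : R) : 0 < e ->
  exists K : nat, forall k, (K <= k)%N -> c / k.+1%:R <= e.
Proof.
move=> e0; exists (Num.bound (`|c| / e)) => k Kk.
rewrite ler_pdivrMr ?ltr0n// mulrC -ler_pdivrMr//.
apply: (@le_trans _ _ (`|c| / e)).
  by rewrite ler_pM2r ?invr_gt0// ler_norm.
have h := archi_boundP (divr_ge0 (normr_ge0 c) (ltW e0)).
by apply: (le_trans (ltW h)); rewrite ler_nat (leq_trans Kk).
Qed.

Lemma near_bounded (P : nat -> nat -> Prop) j :
  (forall i, \forall s \near \oo, P i s) ->
  \forall s \near \oo, forall i, (i <= j)%N -> P i s.
Proof.
move=> Pi; elim: j => [|j IH].
  by apply: filterS (Pi 0%N) => s P0 [].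
apply: filterS2 IH (Pi j.+1) => s h1 h2 i; rewrite leq_eqVlt => /predU1P[->//|].
exact: h1.
Qed.

(* On [1, Ns s], values of [kappa] other than its last two occur only on an
   initial segment [1, t] of negligible logarithmic mass. *)
Lemma slow_index (Phi : nat -> nat -> Prop) :
  (forall j, \forall s \near \oo, Phi j s) ->
  exists kappa : int -> nat,
    (forall J, \forall s \near \oo, (J <= kappa (Ns s)%:Z)%N) /\
    forall s, (0 < kappa (Ns s)%:Z)%N -> Phi (kappa (Ns s)%:Z) s /\
      exists t : nat,
        (kappa (Ns s)%:Z)%:R * logsum R t <= logsum R (Ns s) /\
        forall n : nat, (t < n <= Ns s)%N ->
          kappa n%:Z = kappa (Ns s)%:Z \/ kappa n%:Z = (kappa (Ns s)%:Z).-1.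
Proof.
move=> Phi_near.
have /choice[F FP] : forall j, exists m, forall s, (m <= s)%N -> Phi j s.
  by move=> j; have [m _ mP] := Phi_near j; exists m => s; exact: mP.
have G2 : forall jm : nat * nat, exists m, forall s, (m <= s)%N ->
    jm.1%:R * logsum R (Ns jm.2) <= logsum R (Ns s).
  move=> jm; have [m _ mP] := logsum_near (jm.1%:R * logsum R (Ns jm.2)).
  by exists m => s; exact: mP.
have [G GP] := choice G2.
(* [sigma j] marks the scale after which [kappa] may reach [j]: past it [Phi j] holds, and the
   segment up to the previous threshold has at most a [1 / j] share of the logarithmic mass. *)
pose sigma := fix sigma j := if j is i.+1 then
  maxn (sigma i).+1 (maxn (F i.+1) (G (i.+1, sigma i))) else 0%N.
have sigma_lt i : (sigma i < sigma i.+1)%N by rewrite leq_maxl.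
have sigma_mono : {mono sigma : i j / (i < j)%N}.
  by apply: leqW_mono; apply: leq_mono; apply: homo_ltn => //; exact: ltn_trans.
have leq_sigma j : (j <= sigma j)%N.
  by elim: j => // j IH; exact: leq_ltn_trans (sigma_lt j).
(* [kappa n] will be the largest [j] whose threshold [Ns (sigma j)] lies below [n], with 0 as the
   default; hence only positive [j] are tested. *)
have kex (n : int) : exists k, forall j, (0 < j)%N ->
    (j <= k)%N = ((Ns (sigma j))%:Z < n).
  pose P j := (j == 0%N) || ((Ns (sigma j))%:Z < n).
  have P0 : exists j, P j by exists 0%N.
  have Pub j : P j -> (j <= `|n|)%N.
    case/predU1P => [->//|h]; apply: ltnW.
    apply: (@leq_ltn_trans (Ns (sigma j))).
      by apply: (leq_trans (leq_sigma j)); apply: ltnW; exact: leq_Ns.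
    by move: h; case: n {P P0} => // m; rewrite ltz_nat.
  exists (ex_maxn P0 Pub) => j j0; case: ex_maxnP => k Pk kmax.
  apply/idP/idP => [jk|h]; last by apply: kmax; rewrite /P h orbT.
  move: Pk; rewrite /P => /predU1P[k0|]; first by rewrite k0 leqNgt j0 in jk.
  apply: le_lt_trans; rewrite lez_nat leqNgt ltn_Ns -leqNgt.
  by rewrite leqNgt sigma_mono -leqNgt.
have [kappa kP] := choice kex; exists kappa; split=> [J|s k0].
  (* Passing to [J.+1] provides the positive index that [kP] requires. *)
  exists (sigma J.+1).+1 => // s /= Js; apply: ltnW.
  by rewrite kP// ltz_nat ltn_Ns.
set j := kappa _ in k0 *.
have js : (sigma j < s)%N by rewrite -ltn_Ns -ltz_nat -kP.
have jE : j = j.-1.+1 by rewrite prednK.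
have sj : (maxn (F j) (G (j, sigma j.-1)) <= s)%N.
  by apply: ltnW; apply: leq_ltn_trans js; rewrite [in X in (_ <= X)%N]jE /= -jE leq_maxr.
move: sj; rewrite geq_max => /andP[Fs Gs]; split; first exact: FP.
(* Beyond the threshold of [j.-1], [kappa] is at least [j.-1]. *)
exists (Ns (sigma j.-1)); split; first exact: (GP (j, sigma j.-1)).
move=> n /andP[tn ns].
have h1 : (j.-1 <= kappa n)%N.
  by have [->//|j1] := posnP j.-1; rewrite kP// ltz_nat.
have h2 : (kappa n <= j)%N.
  rewrite leqNgt; apply/negP; rewrite kP// ltz_nat => h.
  have : (j < j)%N by rewrite {2}/j kP// ltz_nat (leq_trans h).
  by rewrite ltnn.
case: (ltngtP (kappa n) j) h2 => // [h _|->]; last by left.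
right; apply/eqP; rewrite eqn_leq h1 andbT; move: h; rewrite {1}jE ltnS.
by [].
Qed.

Lemma Elog_initial N t : (0 < N)%N ->
  Elog N (fun n : int => (n <= t%:Z)%R%:R) <= logsum R t / logsum R N.
Proof.
move=> N0; rewrite /Elog ler_wpM2r ?invr_ge0 ?logsum_ge0//.
have [tN|Nt] := leqP t N.
  rewrite /logsum (@big_nat_widen _ _ _ 1 t.+1 N.+1)// [leRHS]big_mkcond/=.
  apply: ler_sum => n _; rewrite lez_nat ltnS.
  by case: ifP => _; rewrite ?mul1r ?mul0r.
apply: le_trans (logsum_nd (ltnW Nt)).
apply: ler_sum => n _; rewrite -[leRHS]mul1r ler_wpM2r ?invr_ge0//.
by rewrite lern1 leq_b1.
Qed.

(** On [[1, t]] the crude bound [B ^+ 2] is multiplied by a mass of at most [1 / kappa N]; elsewhere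
    the glued function agrees with one of two fixed functions, and both squares are added. *)
Lemma glue_sqavg (kappa : int -> nat) (g : nat -> int -> R[i]) B N t :
  (0 < N)%N -> (0 < kappa N)%N -> (forall k, sup_le (g k) B) ->
  (kappa N)%:R * logsum R t <= logsum R N ->
  (forall n : nat, (t < n <= N)%N ->
    kappa n = kappa N \/ kappa n = (kappa N).-1) ->
  sqavg N (fun n => g (kappa n) n) <=
  B ^+ 2 / (kappa N)%:R + (sqavg N (g (kappa N)) + sqavg N (g (kappa N).-1)).
Proof.
move=> N0 k0 gB tN kP.
have L0 := logsum_gt0 R N0; have k0' : 0 < (kappa N)%:R :> R by rewrite ltr0n.
apply: (@le_trans _ _ (Elog N (fun n : int => B ^+ 2 * (n <= t%:Z)%R%:R +
    (modc (g (kappa N) n) ^+ 2 + modc (g (kappa N).-1 n) ^+ 2)))).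
  apply: le_Elog => n /andP[n0 nN].
  have [nt|tn] := leP n%:Z t%:Z.
    rewrite mulr1 -[leLHS]addr0 lerD ?addr_ge0 ?sqr_ge0//.
    by case/andP: (sup_le_sqr (gB (kappa n)) n).
  rewrite mulr0 add0r.
  have tnN : (t < n <= N)%N by rewrite nN -ltz_nat tn.
  by have [->|->] := kP n tnN; rewrite ?lerDl ?lerDr sqr_ge0.
rewrite ElogD ElogD ElogZ lerD2r ler_wpM2l ?sqr_ge0//.
apply: (le_trans (Elog_initial _ N0)).
by rewrite ler_pdivrMr// -(ler_pM2l k0') mulrA divff ?mul1r// gt_eqF.
Qed.

(** * Near-minimisers and the structured part *)

Lemma msq_parallelogram f g : msq_closure f -> msq_closure g ->
  msq (fun n => f n - g n) = 2 * msq f + 2 * msq g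
    - 4 * msq (fun n => (2^-1)%:C * f n + (1 - 2^-1)%:C * g n).
Proof.
move=> cf cg; set m := (fun n => (2^-1)%:C * f n + (1 - 2^-1)%:C * g n).
have cm : msq_closure m.
  by apply: msq_closure_add; apply: msq_closure_mul => //; exact: msq_closure_cst.
apply: cvg_lim => //.
rewrite (_ : (fun s => _) = (fun s => 2 * sqavg (Ns s) f + 2 * sqavg (Ns s) g
    - 4 * sqavg (Ns s) m)).
  by apply: cvgB; [apply: cvgD|]; apply: cvgM; [exact: cvg_cst|exact: is_cvg_msq|
    exact: cvg_cst|exact: is_cvg_msq|exact: cvg_cst|exact: is_cvg_msq].
apply/funext => s; rewrite /sqavg -!ElogZ -mulN1r -ElogZ -!ElogD.
by apply: eq_Elog => n; rewrite parallelogram_modc mulN1r.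
Qed.

(** The boundary error at finite scales disappears in the limit. *)
Lemma msq_conv_le q U f : conv q U -> msq_closure f -> msq (U f) <= msq f.
Proof.
move=> cU cf; apply/ler_addgt0Pr => e e0; have e2 : 0 < e / 2 by rewrite divr_gt0.
have [B fB] := cf.1.
apply: msq_le_msq; first exact: msq_closure_conv cU cf.
by have := msq_le_conv cU fB e2 (msq_le_near cf e2); rewrite -addrA -splitr.
Qed.

Lemma near_minimizer_single q f e : msq_closure f -> 0 < e -> exists2 U, conv q U &
  forall V, conv q V -> msq (U f) <= msq (V f) + e.
Proof.
move=> cf e0; pose E := [set msq (V f) | V in conv q].
have E0 : has_inf E.
  split; last by exists 0 => _ [V cV <-]; apply: msq_ge0; exact: msq_closure_conv cV cf.
  by exists (msq (fun n => f (n + 0))); exists (fun f n => f (n + 0)) => //;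
    apply: conv_shift; exact: dvdz0.
have [_ [U cU <-] Ue] := inf_adherent e0 E0; exists U => // V cV.
apply: (le_trans (ltW Ue)); rewrite lerD2r; apply: ge_inf; first exact: E0.2.
by exists V.
Qed.

(** Induction on [m]: a near-minimiser [V] for the new function is composed with the earlier [U]. As
    they commute and do not increase [msq], neither spoils what the other achieved. *)
Lemma near_minimizer (d : nat -> int -> R[i]) q m e :
  (forall i, msq_closure (d i)) -> 0 < e -> exists2 U, conv q U &
  forall i V, (i < m)%N -> conv q V -> msq (U (d i)) <= msq (V (d i)) + e.
Proof.
move=> cd e0; elim: m => [|m [U cU UP]].
  by exists (fun f n => f (n + 0)) => //; apply: conv_shift; exact: dvdz0.
have [V cV VP] := near_minimizer_single q (cd m) e0.
exists (fun f => U (V f)) => [|i W]; first exact: conv_comp.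
rewrite ltnS leq_eqVlt => /predU1P[->|im] cW.
  apply: le_trans (VP _ cW); apply: msq_conv_le cU _.
  exact: msq_closure_conv cV _.
rewrite (conv_commute cU cV); apply: le_trans (UP _ _ im cW).
by apply: msq_conv_le cV _; exact: msq_closure_conv cU _.
Qed.

Section structured_part.
Variable d : nat -> int -> R[i].
Hypothesis dA : forall i, A (d i).
Hypothesis d_dense : forall f e, A f -> 0 < e ->
  exists i, sup_le (fun n => f n - d i n) e.
Variable M : nat -> (int -> R[i]) -> int -> R[i].
Hypothesis M_conv : forall k, conv k`!%:Z (M k).
Hypothesis M_min : forall k i V, (i <= k)%N -> conv k`!%:Z V ->
  msq (M k (d i)) <= msq (V (d i)) + k.+1%:R^-1.

Let cd i : msq_closure (d i) := mem_msq_closure (dA i).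

Lemma conv_fact j k U : (k <= j)%N -> conv j`!%:Z U -> conv k`!%:Z U.
Proof.
move=> kj; apply: conv_dvd; rewrite dvdzE !absz_nat -(subnKC kj).
by elim: (j - k)%N => [|l IH]; rewrite ?addn0// addnS factS dvdn_mull.
Qed.

(** The midpoint of [U] and [V] again lies in [conv], so near-minimality of [M k] bounds the
    subtracted term of the parallelogram law from below. *)
Lemma msq_conv_sub_le k i U V : (i <= k)%N -> conv k`!%:Z U -> conv k`!%:Z V ->
  msq (fun n => U (d i) n - V (d i) n) <=
  2 * msq (U (d i)) + 2 * msq (V (d i)) - 4 * msq (M k (d i)) + 4 / k.+1%:R.
Proof.
move=> ik cU cV.
rewrite msq_parallelogram; [|exact: msq_closure_conv cU _|exact: msq_closure_conv cV _].
have h : 0 <= (2^-1 : R) <= 1 by rewrite invr_ge0 ler0n/= invf_le1 ?ltr0n// ler1n.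
rewrite -[leRHS]addrA lerD2l lerNl opprD opprK lerBlDr -mulrDr ler_pM2l//.
exact: (M_min ik (conv_convex h cU cV)).
Qed.

(** Compare [M k] with its own shift: the shift does not increase [msq], so the main terms cancel
    and only the minimisation error remains. *)
Lemma msq_M_almost_inv k i b : (i <= k)%N -> (k`!%:Z %| b)%Z ->
  msq (fun n => M k (d i) (n + b) - M k (d i) n) <= 4 / k.+1%:R.
Proof.
move=> ik kb; have cS := conv_shift R kb.
have := msq_conv_sub_le ik (conv_comp cS (M_conv k)) (M_conv k).
have := msq_conv_le cS (msq_closure_conv (M_conv k) (cd i)).
by move: (msq (fun n => _ - _)) (msq (fun n => _)) (_ / _) => x y z; lra.
Qed.

Lemma msq_M_cauchy i k0 e : 0 < e -> exists k, [/\ (k0 <= k)%N, (i <= k)%N &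
  forall j, (k <= j)%N -> msq (fun n => M j (d i) n - M k (d i) n) <= e].
Proof.
move=> e0; have e2 : 0 < e / 2 by rewrite divr_gt0.
have e4 : 0 < e / 4 by rewrite divr_gt0.
have [K KP] := inv_nat_near 4 e2.
pose K1 := maxn K (maxn i k0).
(* Choose [k] nearly attaining the supremum over the tail. Then [msq (M j (d i))] exceeds
   [msq (M k (d i))] by at most [e / 4] for [j >= k], and this difference enters with factor 2. *)
pose E := [set msq (M k (d i)) | k in [set k | (K1 <= k)%N]].
have hE : has_sup E.
  split; first by exists (msq (M K1 (d i))); exists K1 => //=.
  by exists (msq (d i)) => _ [k _ <-]; exact: msq_conv_le (M_conv k) _.
have [_ [k /= K1k <-] kE] := sup_adherent e4 hE.
move: (K1k); rewrite !geq_max => /and3P[Kk ik k0k].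
exists k; split => // j kj.
apply: (le_trans (msq_conv_sub_le ik (conv_fact kj (M_conv j)) (M_conv k))).
have : msq (M j (d i)) <= sup E.
  apply: ub_le_sup; first exact: hE.2.
  by exists j => //=; exact: leq_trans kj.
have := KP k Kk; move: kE.
by move: (msq (M k _)) (msq (M j _)) (sup E) (_ / _) => x y z w; lra.
Qed.

(** * The glued operator and its mean square estimates *)

Variable kappa : int -> nat.
(* What [M j] must already satisfy at scale [s] before [kappa] may reach [j]. *)
Definition slow_cond j s :=
  (forall i, (i <= j)%N -> forall k, (k <= j)%N -> forall l, (l <= j)%N ->
    sqavg (Ns s) (fun n => M l (d i) n - M k (d i) n) <=
    msq (fun n => M l (d i) n - M k (d i) n) + j.+1%:R^-1) /\
  (forall k, (k <= j)%N -> forall f B, sup_le f B ->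
    sqavg (Ns s) (M k f) <= sqavg (Ns s) f + B ^+ 2 / j.+1%:R).

(** For fixed [j] the first clause consists of finitely many limits. The second covers all [f] at
    once because the constant of [conv_sqavg] does not involve [f]. *)
Lemma slow_cond_near j : \forall s \near \oo, slow_cond j s.
Proof.
apply: filterS2 (fun s => conj (A := _) (B := _)) _ _.
  apply: near_bounded => i; apply: near_bounded => k; apply: near_bounded => l.
  apply: msq_le_near; last by rewrite invr_gt0.
  by apply: msq_closure_sub; exact: msq_closure_conv (M_conv _) _.
apply: near_bounded => k; have [C C0 CP] := conv_sqavg (M_conv k).
apply: filterS (logsum_near (C * j.+1%:R)) => s h f B fB.
have L0 := logsum_gt0 R (Ns_pos s).
apply: (le_trans (CP f B _ (Ns_pos s) fB)); rewrite lerD2l.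
rewrite ler_pdivrMr// mulrAC mulrC -mulrA ler_wpM2l ?sqr_ge0//.
by rewrite ler_pdivlMr// ltr0n.
Qed.

Hypothesis kappa_near : forall J, \forall s \near \oo, (J <= kappa (Ns s)%:Z)%N.
Hypothesis kappa_slow : forall s, (0 < kappa (Ns s)%:Z)%N ->
  slow_cond (kappa (Ns s)%:Z) s /\
  exists t : nat,
    (kappa (Ns s)%:Z)%:R * logsum R t <= logsum R (Ns s) /\
    forall n : nat, (t < n <= Ns s)%N ->
      kappa n%:Z = kappa (Ns s)%:Z \/ kappa n%:Z = (kappa (Ns s)%:Z).-1.

(** The operator S. It is a convex combination of shifts at each point but need not belong to
    [conv], since the index varies with [n]. *)
Definition str f n := M (kappa n) f n.

Lemma str_sup_le f B : sup_le f B -> sup_le (str f) B.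
Proof. by move=> fB n; exact: (conv_sup_le (M_conv (kappa n)) fB). Qed.

Lemma strB f g : str (fun n => f n - g n) = fun n => str f n - str g n.
Proof. by apply/funext => n; rewrite /str (convB (M_conv _)). Qed.

Lemma str_itv f (a b : R) : takes_values_in_itv a b f -> takes_values_in_itv a b (str f).
Proof.
move=> fab _ [n _ <-]; apply: (conv_itv (M_conv (kappa n)) fab).
by exists n.
Qed.

Lemma glue_near (g : nat -> int -> R[i]) B e : (forall k, sup_le (g k) B) ->
  0 < e -> \forall s \near \oo, sqavg (Ns s) (fun n => g (kappa n) n) <=
    e + (sqavg (Ns s) (g (kappa (Ns s))) + sqavg (Ns s) (g (kappa (Ns s)).-1)).
Proof.
move=> gB e0; have [K KP] := inv_nat_near (B ^+ 2) e0.
apply: filterS (kappa_near K.+1) => s Ks.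
have k0 : (0 < kappa (Ns s))%N by exact: leq_trans Ks.
have [_ [t [h1 h2]]] := kappa_slow k0.
apply: (le_trans (glue_sqavg (Ns_pos s) k0 gB h1 h2)); rewrite lerD2r.
by rewrite -(prednK k0); apply: KP; rewrite -ltnS (prednK k0).
Qed.

(** The factor 2 reflects the two values of [kappa] that matter at a given scale; [e] absorbs the
    gluing and boundary errors. *)
Lemma msq_le_str f B a e : sup_le f B -> 0 < e -> msq_le f a ->
  msq_le (str f) (2 * a + e).
Proof.
move=> fB e0 fa; have e2 : 0 < e / 2 by rewrite divr_gt0.
have [K KP] := inv_nat_near (2 * B ^+ 2) e2.
have gB k : sup_le (M k f) B by exact: (conv_sup_le (M_conv k) fB).
near=> s.
have h1 : (K.+1 <= kappa (Ns s))%N by near: s; exact: kappa_near.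
have h2 : sqavg (Ns s) (str f) <=
    e / 2 + (sqavg (Ns s) (M (kappa (Ns s)) f) + sqavg (Ns s) (M (kappa (Ns s)).-1 f)).
  by near: s; exact: (glue_near gB e2).
have h3 : sqavg (Ns s) f <= a by near: s.
have [[_ h4] _] := kappa_slow (leq_trans (ltn0Sn K) h1).
have := KP _ (ltnW h1).
have := h4 _ (leqnn _) _ _ fB; have := h4 _ (leq_pred _) _ _ fB.
move: h2 h3; rewrite -(mulrA 2).
move: (sqavg _ _) (sqavg _ _) (sqavg _ _) (sqavg _ _) (B ^+ 2 / _).
by move=> x y z w v; lra.
Unshelve. all: by end_near.
Qed.

(** At scale [Ns s], [str (d i)] is glued from two late [M l (d i)], both close to [M k (d i)] by
    the Cauchy property. Gluing costs [e / 4], each piece [e / 4 + e / 8]. *)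
Lemma str_approx_dense i k0 e : 0 < e -> exists k, [/\ (k0 <= k)%N, (i <= k)%N &
  msq_le (fun n => str (d i) n - M k (d i) n) e].
Proof.
move=> e0; have e4 : 0 < e / 4 by rewrite divr_gt0.
have [k [k0k ik kP]] := msq_M_cauchy i k0 e4; exists k; split => //.
have [B dB] := (cd i).1.
have [K KP] := inv_nat_near 1 e4.
have e8 : 0 < e / 8 by rewrite divr_gt0.
have [K' KP'] := inv_nat_near 1 e8.
pose g l n := M l (d i) n - M k (d i) n.
have gB l : sup_le (g l) (B + B).
  move=> n; apply: (le_trans (modcB _ _)).
  by rewrite lerD//; [exact: (conv_sup_le (M_conv l) dB)|exact: (conv_sup_le (M_conv k) dB)].
near=> s.
have h1 : ((maxn K' k).+1 <= kappa (Ns s))%N by near: s; exact: kappa_near.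
have h2 : sqavg (Ns s) (fun n => g (kappa n) n) <=
    e / 4 + (sqavg (Ns s) (g (kappa (Ns s))) + sqavg (Ns s) (g (kappa (Ns s)).-1)).
  by near: s; exact: (glue_near gB e4).
apply: (le_trans h2).
have [[h4 _] _] := kappa_slow (leq_trans (ltn0Sn _) h1).
have kk : (k < kappa (Ns s))%N by apply: leq_ltn_trans h1; exact: leq_maxr.
have Kk : (K' <= kappa (Ns s))%N by apply/ltnW/(leq_ltn_trans _ h1); exact: leq_maxl.
have ik' := leq_trans ik (ltnW kk).
have := h4 _ ik' _ (ltnW kk) _ (leqnn _).
have := h4 _ ik' _ (ltnW kk) _ (leq_pred _).
have := kP _ (ltnW kk).
have : msq (g (kappa (Ns s)).-1) <= e / 4.
  by apply: kP; rewrite -ltnS prednK// (leq_ltn_trans _ kk).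
have := KP' _ Kk; rewrite mul1r -/(g _) -/(g _).
move: (sqavg _ _) (sqavg _ _) (msq _) (msq _) (_.+1%:R^-1) => x y z w v.
by lra.
Unshelve. all: by end_near.
Qed.

Lemma str_approx f k0 e : msq_closure f -> 0 < e -> exists i k,
  [/\ (k0 <= k)%N, (i <= k)%N, msq_le (fun n => f n - d i n) e &
      msq_le (fun n => str f n - M k (d i) n) e].
Proof.
(* The final error is [20 a]: [4 a] for the distance from [f] to [d i], hence [9 a] after [str],
   then one more triangle inequality. *)
move=> [[B fB] fA] e0; pose a := e / 32; have a0 : 0 < a by rewrite divr_gt0.
have [g Ag hg] := fA _ a0.
have [b b0 bb] := small_sqr a0.
have [i di] := d_dense Ag b0.
have fd : msq_le (fun n => f n - d i n) (4 * a).
  have := msq_le_trans hg (msq_leW bb (msq_le_sup di)).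
  by apply: msq_leW; lra.
have [k [k0k ik ks]] := str_approx_dense i k0 a0.
exists i, k; split => //; first by apply: msq_leW fd; rewrite /a; lra.
have [D dD] := (cd i).1.
have fdB : sup_le (fun n => f n - d i n) (B + D).
  by move=> n; apply: (le_trans (modcB _ _)); exact: lerD.
have := msq_le_str fdB a0 fd; rewrite strB => h.
by have := msq_le_trans h ks; apply: msq_leW; rewrite /a; lra.
Qed.

(** The approximants [M k (d i)] lie in [A]. *)
Lemma msq_closure_str f : msq_closure f -> msq_closure (str f).
Proof.
move=> cf; split; first by have [B fB] := cf.1; exists B; exact: str_sup_le.
move=> e e0; have [i [k [_ _ _ h]]] := str_approx 0 cf e0.
by exists (M k (d i)) => //; exact: (conv_mem CA TA (M_conv k)).
Qed.

(** The period is [k!]. Pass from [str f] to the almost invariant [M k (d i)], shift, and return;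
    the total [18 a] does not depend on [m]. *)
Lemma str_quasiperiodic f : msq_closure f -> locally_quasiperiodic Ns (str f).
Proof.
move=> cf e e0; pose a := e / 32; have a0 : 0 < a by rewrite divr_gt0.
have [K KP] := inv_nat_near 4 a0.
have [i [k [Kk ik _ h]]] := str_approx K cf a0.
exists k`!; first exact: fact_gt0.
apply: ge_ereal_sup => _ [m _ <-]; rewrite lee_fin.
pose b : int := k`!%:Z * m%:Z; have kb : (k`!%:Z %| b)%Z by exact: dvdz_mulr.
have cS := conv_shift R kb.
have cM := msq_closure_conv (M_conv k) (cd i).
have cstr := msq_closure_str cf.
have [B hB] := (msq_closure_sub cstr cM).1.
have h1 := msq_le_conv cS hB a0 h; rewrite /= in h1.
have h2 : msq_le (fun n => M k (d i) (n + b) - M k (d i) n) (a + a).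
  apply: msq_leW (msq_le_near _ a0).
    by rewrite lerD2r; apply: le_trans (KP _ Kk); exact: msq_M_almost_inv.
  by apply: msq_closure_sub => //; exact: msq_closure_conv cS cM.
have h3 := msq_le_trans (msq_le_trans h1 h2) (msq_leC h).
apply: msq_le_msq; last by apply: msq_leW h3; rewrite /a; lra.
by apply: msq_closure_sub => //; exact: msq_closure_conv cS cstr.
Qed.

(** Split the remainder as [(f - d i) + (d i - M k (d i)) + (M k (d i) - str f)]. Averaging keeps
    the outer terms small, and the averages of the middle one telescope. *)
Lemma str_aperiodic f : msq_closure f ->
  locally_aperiodic Ns (fun n => f n - str f n).
Proof.
move=> cf q q0; set r := fun n => f n - str f n.
have cstr := msq_closure_str cf.
have cr : msq_closure r by exact: msq_closure_sub.
apply/cvgrPdist_le => e e0; pose a := e / 32; have a0 : 0 < a by rewrite divr_gt0.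
(* Taking [k] at least the absolute value of [q] makes [q] divide [k!]. *)
have [i [k [qk ik h1 h2]]] := str_approx `|q| cf a0.
have cq : conv q (M k).
  apply: conv_dvd (M_conv k); rewrite dvdzE absz_nat dvdn_fact//.
  by rewrite absz_gt0 q0.
have [C C0 CP] := avg_sub_conv cq.
have [B dB] := (cd i).1; have B0 := sup_le_ge0 dB.
have [b b0 bb] := small_sqr a0.
have [K KP] := inv_nat_near (C * B) b0.
(* A positive threshold discards the empty average. *)
exists K.+1 => // -[//|H] /= KH.
rewrite sub0r normrN.
have cavg := conv_avg R q H.
change (`|msq (avg q H.+1 r)| <= e).
have cavgr := msq_closure_conv cavg cr.
rewrite ger0_norm ?msq_ge0//; apply: msq_le_msq => //.
have cM := msq_closure_conv (M_conv k) (cd i).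
have g1 : msq_le (avg q H.+1 (fun n => f n - d i n)) (a + a).
  have [D hD] := (msq_closure_sub cf (cd i)).1.
  exact: (msq_le_conv cavg hD a0 h1).
have g2 : msq_le (avg q H.+1 (fun n => M k (d i) n - str f n)) (a + a).
  have [D hD] := (msq_closure_sub cM cstr).1.
  exact: (msq_le_conv cavg hD a0 (msq_leC h2)).
have g3 : msq_le (avg q H.+1 (fun n => d i n - M k (d i) n)) a.
  apply: (msq_leW bb); apply: msq_le_sup => n.
  by apply: (le_trans (CP _ _ _ _ _ dB)) => //; exact: KP.
rewrite (_ : avg q H.+1 r = fun n => avg q H.+1 (fun n => f n - d i n) n +
   (avg q H.+1 (fun n => d i n - M k (d i) n) n +
    avg q H.+1 (fun n => M k (d i) n - str f n) n)).
  by apply: msq_leW (msq_leD g1 (msq_leD g3 g2)); rewrite /a; lra.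
apply/funext => n; rewrite -!avgD; congr (avg _ _ _ n); apply/funext => m.
by rewrite /r; ring.
Qed.

(** * The extended algebra *)

(** Scalars are left out to keep the set countable; they return in [ext] through the constants of
    [A]. *)
Inductive generated : set (int -> R[i]) :=
| gen_dense i : generated (d i)
| gen_add f g : generated f -> generated g -> generated (fun n => f n + g n)
| gen_mul f g : generated f -> generated g -> generated (fun n => f n * g n)
| gen_conj f : generated f -> generated (fun n => (f n)^*)
| gen_shift f (b : int) : generated f -> generated (fun n => f (n + b))
| gen_str f : generated f -> generated (str f).

(* Terms for the generating operations, encoded as trees to inherit their
   countability; ill-formed trees get the junk value [d 0]. *)
Fixpoint gen_eval (t : GenTree.tree nat) : int -> R[i] :=
  match t with
  | GenTree.Leaf i => d i
  | GenTree.Node 0 [:: t; u] => fun n => gen_eval t n + gen_eval u n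
  | GenTree.Node 1 [:: t; u] => fun n => gen_eval t n * gen_eval u n
  | GenTree.Node 2 [:: t] => fun n => (gen_eval t n)^*
  | GenTree.Node 3 [:: t] => str (gen_eval t)
  | GenTree.Node k.+4 [:: t] => fun n => gen_eval t (n + odflt 0 (unpickle k))
  | _ => d 0
  end.

Lemma countable_generated : countable generated.
Proof.
apply: (@sub_countable _ _ _ (range gen_eval)); last first.
  exact: card_le_trans (card_image_le _ _) (countableP _).
apply: subset_card_le => f; elim.
- by move=> i; exists (GenTree.Leaf i).
- by move=> ? ? _ [t _ <-] _ [u _ <-]; exists (GenTree.Node 0 [:: t; u]).
- by move=> ? ? _ [t _ <-] _ [u _ <-]; exists (GenTree.Node 1 [:: t; u]).
- by move=> ? _ [t _ <-]; exists (GenTree.Node 2 [:: t]).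
- move=> ? b _ [t _ <-]; exists (GenTree.Node (pickle b).+4 [:: t]) => //=.
  by rewrite pickleK.
- by move=> ? _ [t _ <-]; exists (GenTree.Node 3 [:: t]).
Qed.

Lemma generated_msq_closure f : generated f -> msq_closure f.
Proof.
elim=> [i|{}f g _ cf _ cg|{}f g _ cf _ cg|{}f _ cf|{}f b _ cf|{}f _ cf].
- exact: cd.
- exact: msq_closure_add.
- exact: msq_closure_mul.
- exact: msq_closure_conj.
(* The shift by [b] is an operator of [conv b]. *)
- exact: msq_closure_conv (conv_shift R (dvdzz b)) cf.
- exact: msq_closure_str.
Qed.

(** The norm closure, phrased with pointwise bounds to avoid handling [supnorm]. *)
Definition ext f := (exists B, sup_le f B) /\
  forall e, 0 < e -> exists2 g, generated g & sup_le (fun n => f n - g n) e.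

Lemma generated_bounded f : generated f -> exists B, sup_le f B.
Proof. by case/generated_msq_closure. Qed.

Lemma generated_ext f : generated f -> ext f.
Proof.
move=> gf; split; first exact: generated_bounded.
by move=> e e0; exists f => // n; rewrite subrr modc0 ltW.
Qed.

Lemma ext_A f : A f -> ext f.
Proof.
move=> Af; split; first exact: Cstar_bounded.
move=> e e0; have [i di] := d_dense Af e0.
by exists (d i) => //; exact: gen_dense.
Qed.

Lemma ext_add f g : ext f -> ext g -> ext (fun n => f n + g n).
Proof.
move=> [[B fB] fG] [[D gD] gG]; split.
  by exists (B + D) => n; apply: (le_trans (modcD _ _)); exact: lerD.
move=> e e0; have e2 : 0 < e / 2 by rewrite divr_gt0.
have [f' Gf' hf] := fG _ e2; have [g' Gg' hg] := gG _ e2.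
exists (fun n => f' n + g' n); first exact: gen_add.
move=> n; rewrite opprD addrACA (splitr e).
by apply: (le_trans (modcD _ _)); exact: lerD.
Qed.

Lemma ext_mul f g : ext f -> ext g -> ext (fun n => f n * g n).
Proof.
move=> [[B fB] fG] [[D gD] gG]; split.
  by exists (B * D) => n; rewrite modcM ler_pM ?modc_ge0.
move=> e e0; have e2 : 0 < e / 2 by rewrite divr_gt0.
have [c c0 Bc] := small_mul (sup_le_ge0 fB) e2.
have [g' Gg' hg] := gG _ c0; have [D' gD'] := generated_bounded Gg'.
have [c' c'0 Dc'] := small_mul (sup_le_ge0 gD') e2.
have [f' Gf' hf] := fG _ c'0.
exists (fun n => f' n * g' n); first exact: gen_mul.
move=> n; have -> : f n * g n - f' n * g' n =
  f n * (g n - g' n) + g' n * (f n - f' n) by ring.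
rewrite (splitr e); apply: (le_trans (modcD _ _)); rewrite !modcM lerD//.
  by apply: le_trans Bc; rewrite ler_pM ?modc_ge0.
by apply: le_trans Dc'; rewrite ler_pM ?modc_ge0.
Qed.

Lemma ext_lin (a b : R[i]) f g : ext f -> ext g -> ext (fun n => a * f n + b * g n).
Proof.
move=> ef eg; have ec (c : R[i]) : ext (fun=> c).
  apply: ext_A; rewrite (_ : (fun=> c) = (fun n => c * 1 + 0 * 1)).
    by apply: (Cstar_lin CA); exact: (Cstar_one CA).
  by apply/funext => n; rewrite mulr1 mul0r addr0.
exact: ext_add (ext_mul (ec a) ef) (ext_mul (ec b) eg).
Qed.

Lemma ext_conj f : ext f -> ext (fun n => (f n)^*).
Proof.
move=> [[B fB] fG]; split; first by exists B => n; rewrite modcJ.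
move=> e /fG[g Gg hg]; exists (fun n => (g n)^*); first exact: gen_conj.
by move=> n; rewrite -rmorphB modcJ.
Qed.

Lemma ext_shift f (b : int) : ext f -> ext (fun n => f (n + b)).
Proof.
move=> [[B fB] fG]; split; first by exists B => n.
move=> e /fG[g Gg hg]; exists (fun n => g (n + b)); first exact: gen_shift.
by move=> n; exact: hg.
Qed.

(** Linearity and contraction of the sup norm carry [str] over to the closure. *)
Lemma ext_str f : ext f -> ext (str f).
Proof.
move=> [[B fB] fG]; split; first by exists B; exact: str_sup_le.
move=> e /fG[g Gg hg]; exists (str g); first exact: gen_str.
by have := str_sup_le hg; rewrite strB.
Qed.

Lemma ext_sub f g : ext f -> ext g -> ext (fun n => f n - g n).
Proof.
move=> ef eg; have := ext_lin 1 (-1) ef eg.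
by congr ext; apply/funext => n; rewrite mul1r mulN1r.
Qed.

Lemma supnorm_le f B : sup_le f B -> supnorm f <= B.
Proof.
move=> fB; apply: ge_sup; first by exists (modc (f 0)); exists 0.
by move=> _ [n _ <-].
Qed.

(** Boundedness is essential: [sup] of an unbounded set is a default value. *)
Lemma sup_le_supnorm f : linfty f -> sup_le f (supnorm f).
Proof.
move=> [B fB] n; apply: ub_le_sup; last by exists n.
by exists B => _ [m _ <-].
Qed.

Lemma ext_closed f : linfty f -> (forall e, 0 < e ->
  exists2 g, ext g & supnorm (fun n => f n - g n) < e) -> ext f.
Proof.
move=> [B fB] fE; split; first by exists B.
move=> e e0; have e2 : 0 < e / 2 by rewrite divr_gt0.
have [g [[D gD] gG] fg] := fE _ e2; have [h Gh gh] := gG _ e2.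
exists h => // n; rewrite (splitr e) -(subrK (g n) (f n)) -addrA.
apply: (le_trans (modcD _ _)); apply: lerD => //.
have bfg : linfty (fun n => f n - g n).
  by exists (B + D) => m; apply: (le_trans (modcB _ _)); exact: lerD.
by apply: le_trans (ltW fg); exact: (sup_le_supnorm bfg).
Qed.

(** Uniform approximation implies approximation in mean square, so existence of averages passes to
    [ext]. *)
Lemma ext_msq_closure f : ext f -> msq_closure f.
Proof.
move=> [fB fG]; split => // e e0; have e4 : 0 < e / 4 by rewrite divr_gt0.
have [b b0 bb] := small_sqr e4.
have [g Gg fg] := fG _ b0.
have [h Ah gh] := (generated_msq_closure Gg).2 _ e4; exists h => //.
by apply: msq_leW (msq_le_trans (msq_leW bb (msq_le_sup fg)) gh); lra.
Qed.

Lemma ext_Cstar : Cstar_subalgebra ext.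
Proof.
split.
- by move=> f [].
- exact/ext_A/(Cstar_one CA).
- by move=> a b f g; exact: ext_lin.
- by move=> f g; exact: ext_mul.
- by move=> f; exact: ext_conj.
- exact: ext_closed.
Qed.

Lemma ext_separable : norm_separable ext.
Proof.
exists generated; split; first exact: countable_generated.
  by move=> f; exact: generated_ext.
move=> f [_ fG] e e0; have e2 : 0 < e / 2 by rewrite divr_gt0.
have [g Gg fg] := fG _ e2; exists g => //.
by apply: (le_lt_trans (supnorm_le fg)); rewrite ltr_pdivrMr// ltr_pMr// ltr1n.
Qed.

End structured_part.

End mean_square_closure.

(** * Dense sequences and construction of the extension *)

Lemma dense_sequence (R : realType) (A : set (int -> R[i])) :
  Cstar_subalgebra A -> norm_separable A ->
  exists2 d : nat -> int -> R[i], (forall i, A (d i)) &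
    forall f e, A f -> 0 < e -> exists i, sup_le (fun n => f n - d i n) e.
Proof.
move=> CA [D [cD DA dD]].
(* Approximating the constant 1 shows that [D] is nonempty, so that it can be enumerated by a
   sequence. *)
have [g0 Dg0 _] := dD _ (Cstar_one CA) 1 ltr01.
have /pfcard_geP[D0|/unsquash d] : (D #<= [set: nat])%card by [].
  by move: Dg0; rewrite D0.
have dsurj : set_surj [set: nat] D d by exact: surj.
have dfun i : D (d i) by exact: funS.
exists d => [i|f e Af e0]; first exact: DA.
have [g Dg fg] := dD f Af e e0; have [i _ dig] := dsurj _ Dg.
exists i => n; rewrite dig; apply: le_trans (ltW fg).
have [B fB] := Cstar_linfty CA Af; have [B' gB'] := Cstar_linfty CA (DA _ Dg).
apply: (@sup_le_supnorm _ (fun n => f n - g n)).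
by exists (B + B') => m; apply: (le_trans (modcB _ _)); exact: lerD.
Qed.

Theorem theorem3p2 (R : realType) (Ns : nat -> nat)
    (Ns_gt0 : (0 < Ns 0)%N) (Ns_incr : forall s : nat, (Ns s < Ns s.+1)%N)
    (A : set (int -> R[i])) :
  Cstar_subalgebra A -> norm_separable A -> translation_invariant A ->
  admits_Elog Ns A ->
  exists A' : set (int -> R[i]),
    [/\ Cstar_subalgebra A', norm_separable A', translation_invariant A',
        admits_Elog Ns A' & A `<=` A'] /\
    forall f : int -> R[i], A' f ->
      exists fstr frnd : int -> R[i],
        [/\ A' fstr, A' frnd & forall n : int, f n = fstr n + frnd n] /\
        [/\ locally_quasiperiodic Ns fstr, locally_aperiodic Ns frnd &
            forall a b : R,
              takes_values_in_itv a b f -> takes_values_in_itv a b fstr].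
Proof.
move=> CA SA TA EA.
have [d dA d_dense] := dense_sequence CA SA.
have cd i : msq_closure Ns A (d i) by exact: mem_msq_closure.
have /choice[M MP] : forall k, exists U : (int -> R[i]) -> int -> R[i],
    conv k`!%:Z U /\ forall i V, (i < k.+1)%N -> conv k`!%:Z V ->
      msq Ns (U (d i)) <= msq Ns (V (d i)) + k.+1%:R^-1.
  move=> k; have k0 : (0 : R) < k.+1%:R^-1 by rewrite invr_gt0.
  have [U cU UP] := near_minimizer Ns_gt0 Ns_incr CA TA EA k`!%:Z k.+1 cd k0.
  by exists U.
have M_conv k := (MP k).1; have M_min k i V := (MP k).2 i V.
(* The index is chosen only now, since its slowness depends on the operators [M]. *)
have [kappa [kappa_near kappa_slow]] := slow_index R Ns_gt0 Ns_incr
  (slow_cond_near Ns_gt0 Ns_incr CA TA EA dA M_conv).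
exists (ext d M kappa); split.
  split.
  - exact: (ext_Cstar Ns_gt0 Ns_incr CA TA EA dA d_dense
      M_conv M_min kappa_near kappa_slow).
  - exact: (ext_separable Ns_gt0 Ns_incr CA TA EA dA d_dense
      M_conv M_min kappa_near kappa_slow).
  - by move=> f b; exact: ext_shift.
  - move=> f ef; apply: (msq_closure_has_Elog Ns_gt0 Ns_incr CA EA).
    exact: (ext_msq_closure Ns_gt0 Ns_incr CA TA EA dA d_dense
      M_conv M_min kappa_near kappa_slow).
  - exact: (ext_A CA d_dense).
move=> f ef.
have cf : msq_closure Ns A f.
  exact: (ext_msq_closure Ns_gt0 Ns_incr CA TA EA dA d_dense
    M_conv M_min kappa_near kappa_slow).
have est : ext d M kappa (str M kappa f) by exact: ext_str.
exists (str M kappa f), (fun n => f n - str M kappa f n); split; split => //.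
- exact: (ext_sub Ns_gt0 Ns_incr CA TA EA dA d_dense
    M_conv M_min kappa_near kappa_slow).
- by move=> n; rewrite addrC subrK.
- exact: (str_quasiperiodic Ns_gt0 Ns_incr CA TA EA dA d_dense
    M_conv M_min kappa_near kappa_slow).
- exact: (str_aperiodic Ns_gt0 Ns_incr CA TA EA dA d_dense
    M_conv M_min kappa_near kappa_slow).
- by move=> a b; exact: str_itv.
Qed.
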